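(* Let $\mathbb{K}$ be a field of characteristic not $2$ and let $n\geq 3$. Let $\mathcal{V}$ be a linear subspace of $M_n(\mathbb{K})$ such that every $M\in\mathcal{V}$ has at most two distinct eigenvalues in $\mathbb{K}$. Then $\dim\mathcal{V}\leq \binom{n}{2}+2$.
   Context: $M_n(\mathbb{K})$ denotes the algebra of $n\times n$ matrices over $\mathbb{K}$. Only eigenvalues lying in $\mathbb{K}$ itself are counted. *)

(* Defs.v *)
From HB Require Import structures.
From mathcomp Require Import all_boot all_order all_algebra.
Set Implicit Arguments. Unset Strict Implicit. Unset Printing Implicit Defensive.
Import GRing.Theory.
Local Open Scope ring_scope.

Definition at_most_two_eigenvalues (F : fieldType) (n : nat) (M : 'M[F]_n) : Prop :=
  forall a b c : F, eigenvalue M a -> eigenvalue M b -> eigenvalue M c ->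
    [\/ a = b, a = c | b = c].

(* Main.v *)
Require Import Defs.
From HB Require Import structures.
From mathcomp Require Import all_boot all_order all_algebra.
From mathcomp Require Import ring zify.
From Stdlib Require Import Classical.
Set Implicit Arguments. Unset Strict Implicit. Unset Printing Implicit Defensive.
Import GRing.Theory.
Local Open Scope ring_scope.

(** Let matrices act on row vectors, and let V^x be the space of columns phi with
phi *m x in V.  For x != 0, the matrices of V having x as an eigenvector have
codimension at most n - 1; they act on the quotient by x, and the kernel of this
action is V^x *m x.  If V^x = 0 for some x, induction on n applies.

Otherwise choose theta_x != 0 in V^x for each x.  If x theta_y and y theta_x
are both nonzero while the diagonal values x theta_x and y theta_y vanish, then
a combination of theta_x x and theta_y y has rank two and eigenvalues 1, -1, 0.
A counting argument on cubes of vectors yields such a pair unless some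
x phi = 1 with phi x in V; the same argument on the kernel of phi then shows that
phi y lies in V for every row y.  Hence V^x is the line spanned by phi, and as
phi x shifts the eigenvalue on x freely, the matrices induced on the quotient have
at most one eigenvalue; for such spaces the bound is 'C(n - 1, 2) + 1, again
by the cube argument and induction. *)

(** * Pairing of rows with columns, and rank-one matrices *)

Definition dot (F : fieldType) n (y : 'rV[F]_n) (phi : 'cV[F]_n) : F := (y *m phi) 0 0.

Lemma mul_rank1 (F : fieldType) n (v y : 'rV[F]_n) (phi : 'cV[F]_n) :
  v *m (phi *m y) = dot v phi *: y.
Proof. by rewrite mulmxA [v *m phi]mx11_scalar mul_scalar_mx. Qed.

Lemma dotE (F : fieldType) n (y : 'rV[F]_n) (phi : 'cV[F]_n) : y *m phi = (dot y phi)%:M.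
Proof. exact: mx11_scalar. Qed.

Lemma dotDl (F : fieldType) n (y z : 'rV[F]_n) (phi : 'cV[F]_n) :
  dot (y + z) phi = dot y phi + dot z phi.
Proof. by rewrite /dot mulmxDl mxE. Qed.

Lemma dotDr (F : fieldType) n (y : 'rV[F]_n) (phi psi : 'cV[F]_n) :
  dot y (phi + psi) = dot y phi + dot y psi.
Proof. by rewrite /dot mulmxDr mxE. Qed.

Lemma dotZl (F : fieldType) n a (y : 'rV[F]_n) (phi : 'cV[F]_n) :
  dot (a *: y) phi = a * dot y phi.
Proof. by rewrite /dot -scalemxAl mxE. Qed.

Lemma dotZr (F : fieldType) n a (y : 'rV[F]_n) (phi : 'cV[F]_n) :
  dot y (a *: phi) = a * dot y phi.
Proof. by rewrite /dot -scalemxAr mxE. Qed.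

Lemma dot0l (F : fieldType) n (phi : 'cV[F]_n) : dot 0 phi = 0.
Proof. by rewrite /dot mul0mx mxE. Qed.

(** * Cubes of vectors and the zeros of linear functionals on them *)

Section Toggle.
Variables (F : fieldType) (m n : nat) (w : 'rV[F]_n) (E : 'M[F]_(m, n)).

Definition cube_point (I : {set 'I_m}) : 'rV[F]_n := w + \sum_(i in I) row i E.

Definition toggle (i : 'I_m) (I : {set 'I_m}) := if i \in I then I :\ i else i |: I.

Lemma toggleK i : involutive (toggle i).
Proof.
move=> I; rewrite /toggle; have [iI|iI] := boolP (i \in I).
  by rewrite setD11 setD1K.
by rewrite setU11 setU1K.
Qed.

Lemma cube_point_toggle i I :
  cube_point (toggle i I) = cube_point I + (if i \in I then - row i E else row i E).
Proof.
rewrite /cube_point /toggle; case: ifP => iI.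
  by rewrite [in RHS](big_setD1 i) //=; rewrite addrA addrAC addrK.
by rewrite big_setU1 ?iI //= addrA addrAC.
Qed.

(* Toggling a coordinate on which the functional is nonzero leaves its zero set. *)
Lemma card_vanishing th :
  (w *m th != 0) || (E *m th != 0) ->
  (#|[set I | dot (cube_point I) th == 0%R]| * 2 <= #|{set 'I_m}|)%N.
Proof.
have [Eth0|Eth0] := eqVneq (E *m th) 0.
  rewrite orbF => wth0; suff -> : [set I | dot (cube_point I) th == 0%R] = set0.
    by rewrite cards0.
  apply/setP=> I; rewrite !inE /dot mulmxDl mulmx_suml big1 ?addr0.
    by apply/negbTE; apply: contra wth0 => /eqP h; rewrite [w *m th]mx11_scalar h raddf0.
  by move=> i _; rewrite -row_mul Eth0 row0.
move=> _; have [i rth0] : exists i, dot (row i E) th != 0.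
  apply/existsP; apply: contraR Eth0; rewrite negb_exists => /forallP h.
  apply/eqP/row_matrixP => i; rewrite row_mul row0 dotE.
  by move: (h i); rewrite negbK => /eqP->; rewrite raddf0.
set A := [set I | _]; rewrite muln2 -addnn.
have disj : [disjoint A & toggle i @: A].
  rewrite -setI_eq0; apply/eqP/setP=> I; rewrite !inE; apply/negbTE/negP.
  case/andP=> /eqP h1 /imsetP[J]; rewrite inE => /eqP h2 IJ.
  move: h1; rewrite IJ cube_point_toggle dotDl h2 add0r.
  case: ifP => _ /eqP; last by rewrite (negbTE rth0).
  by rewrite -scaleN1r dotZl mulN1r oppr_eq0 (negbTE rth0).
rewrite -{2}(card_imset A (can_inj (toggleK i))).
by move: disj; rewrite -leq_card_setU => /eqP <-; apply: max_card.
Qed.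

(* Every ordered pair (I, J) is a zero of the pairing in one of its two orders and
   the diagonal counts twice, so some [th J] vanishes on more than half the cube. *)
Lemma cube_tournament (th : {set 'I_m} -> 'cV[F]_n) :
  (forall I J, dot (cube_point I) (th J) = 0 \/ dot (cube_point J) (th I) = 0) ->
  exists I, w *m th I = 0 /\ E *m th I = 0.
Proof.
move=> h; suff /existsP[I] : [exists I, (w *m th I == 0) && (E *m th I == 0)].
  by case/andP=> /eqP ? /eqP ?; exists I.
apply: contraT; rewrite negb_exists => /forallP nv; exfalso.
pose P I J : nat := dot (cube_point I) (th J) == 0.
have up : (\sum_J (\sum_I P I J) * 2 <= #|{set 'I_m}| * #|{set 'I_m}|)%N.
  rewrite -[X in (_ <= X)%N]sum_nat_const; apply: leq_sum => J _.
  rewrite (eq_bigr (fun I => if dot (cube_point I) (th J) == 0 then 1%N else 0%N)).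
    rewrite -big_mkcond sum1dep_card; apply: card_vanishing.
    by rewrite -negb_and nv.
  by move=> I _; rewrite /P; case: eqP.
have lo : (#|{set 'I_m}| * #|{set 'I_m}| + #|{set 'I_m}| <= \sum_J (\sum_I (P I J + P J I)))%N.
  rewrite -mulnSr -sum_nat_const; apply: leq_sum => J _.
  have -> : (#|{set 'I_m}|.+1 = \sum_(I : {set 'I_m}) (1 + (I == J)))%N.
    rewrite big_split /= sum1_card (bigD1 J) //= eqxx big1 ?addn0 ?addn1 //.
    by move=> I /negbTE->.
  apply: leq_sum => I _; rewrite /P; have [->|_] := eqVneq I J.
    by case: (h J J) => ->; rewrite eqxx.
  by case: (h I J) => ->; rewrite eqxx // addn1.
move: up; rewrite -big_distrl /= => up; move: lo.
under eq_bigr do rewrite big_split /=.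
rewrite big_split /= [X in (_ <= _ + X)%N]exchange_big /= addnn -muln2.
move=> lo; have := leq_trans lo up.
rewrite -[X in (_ <= X)%N]addn0 leq_add2l leqn0 => /eqP/card0_eq/(_ set0).
by rewrite inE.
Qed.
End Toggle.

(** * Eigenvalues of matrices of rank one and two *)

Lemma eigenvalueE (F : fieldType) n (M : 'M[F]_n) a :
  eigenvalue M a = (\det (M - a%:M) == 0).
Proof.
rewrite /eigenvalue /eigenspace kermx_eq0 row_free_unit unitmxE unitfE.
by rewrite negbK.
Qed.

Lemma eigenvalue_rank1 (F : fieldType) n (phi : 'cV[F]_n) (x : 'rV[F]_n) :
  dot x phi != 0 -> eigenvalue (phi *m x) (dot x phi).
Proof.
move=> h; apply/eigenvalueP; exists x; first by rewrite mul_rank1.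
by apply: contraNneq h => ->; rewrite dot0l.
Qed.

Lemma eigenvalue0 (F : fieldType) n (M : 'M[F]_n) : (\rank M < n)%N -> eigenvalue M 0.
Proof.
move=> rM; rewrite /eigenvalue /eigenspace raddf0 subr0 kermx_eq0 /row_free.
by rewrite neq_ltn rM.
Qed.

Lemma rank_rank1 (F : fieldType) n (phi : 'cV[F]_n) (x : 'rV[F]_n) : (\rank (phi *m x) <= 1)%N.
Proof. exact: leq_trans (mxrankM_maxr _ _) (rank_leq_row _). Qed.

Lemma rank_rank2 (F : fieldType) n (phi psi : 'cV[F]_n) (x y : 'rV[F]_n) :
  (\rank (phi *m x + psi *m y)%R <= 2)%N.
Proof.
exact: leq_trans (mxrank_add _ _) (leq_add (rank_rank1 _ _) (rank_rank1 _ _)).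
Qed.

(** The witness exchanges two lines: it sends [y] to [a^-1 *: z] and [z] to [a *: y], so it fixes
    [a^-1 *: z + y] and negates [- a^-1 *: z + y]. *)
Lemma swap_eigenvalues (F : fieldType) n (V : {vspace 'M[F]_n}) (y z : 'rV[F]_n) (th et : 'cV[F]_n) :
  dot y th = 0 -> dot z et = 0 -> dot z th != 0 -> dot y et != 0 ->
  th *m y \in V -> et *m z \in V ->
  exists M, [/\ M \in V, (\rank M <= 2)%N, eigenvalue M 1 & eigenvalue M (- 1)].
Proof.
move=> yth zet zth yet thV etV.
pose a := dot z th; pose b := dot y et.
pose M := th *m y + (a * b)^-1 *: et *m z.
have yM : y *m M = a^-1 *: z.
  rewrite mulmxDr !mul_rank1 yth scale0r add0r dotZr -/b invfM -mulrA mulVf //.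
  by rewrite mulr1.
have zM : z *m M = a *: y by rewrite mulmxDr !mul_rank1 dotZr zet mulr0 scale0r addr0.
have y0 k : k *: z + y != 0.
  apply: contraNneq yet => /(congr1 (fun v => dot v et)).
  by rewrite dotDl dotZl zet mulr0 add0r dot0l => ->.
exists M; split; last 2 first.
- apply/eigenvalueP; exists (a^-1 *: z + y) => //.
  by rewrite mulmxDl -scalemxAl yM zM scalerA mulVf // scale1r scale1r addrC.
- apply/eigenvalueP; exists (- a^-1 *: z + y) => //.
  rewrite mulmxDl -scalemxAl yM zM scalerA mulNr mulVf // !scaleN1r opprD.
  by rewrite scaleNr opprK addrC.
- by rewrite memvD // -scalemxAl memvZ.
exact: rank_rank2.
Qed.

(** * Deflation along a common eigenvector *)

Lemma exists_unitmx_row (F : fieldType) m (x : 'rV[F]_(1 + m)) : x != 0 ->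
  exists B : 'M[F]_(1 + m), B \in unitmx /\ usubmx B = x.
Proof.
move=> x0; have [j xj] : exists j, x 0 j != 0 by apply/rV0Pn.
have rx : \rank x = 1%N by rewrite rank_rV x0.
have E := mulmx_ebase x; rewrite rx in E.
pose c := (col_ebase x) 0 0.
have c0 : c != 0.
  have := col_ebase_unit x; rewrite unitmxE [col_ebase x]mx11_scalar det_scalar1.
  by rewrite unitfE.
pose R : 'M[F]_(1 + m) := row_ebase x.
(* [x] is [c] times the first row of [R], so scaling the whole basis by [c] makes [x] itself the
   first row. *)
exists (c *: R); split; first by rewrite unitmxZ ?unitfE // row_ebase_unit.
rewrite -E [col_ebase x]mx11_scalar -/c mul_scalar_mx -/R.
apply/rowP=> k; rewrite !mxE big_split_ord /= big_ord1 !mxE /= big1 ?addr0.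
  by rewrite mulr1 //; congr (_ * R _ _); apply/val_inj.
by move=> i _; rewrite !mxE /= mulr0 mul0r.
Qed.

Section Deflation.
Variables (F : fieldType) (m : nat) (B : 'M[F]_(1 + m)).
Hypothesis uB : B \in unitmx.

(** The rows of [B] form a basis; this is the matrix of [v |-> v *m M] in that basis. *)
Definition conj_mx (M : 'M[F]_(1 + m)) : 'M[F]_(1 + m) := B *m M *m invmx B.

Fact conj_mx_is_linear : linear conj_mx.
Proof. by move=> a M N; rewrite /conj_mx mulmxDr mulmxDl -scalemxAr -scalemxAl. Qed.
HB.instance Definition _ := GRing.isLinear.Build F _ _ _ conj_mx conj_mx_is_linear.

Let ur_conj M := ursubmx (conj_mx M).
Let dr_conj M := drsubmx (conj_mx M).

Fact ur_conj_is_linear : linear ur_conj.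
Proof. by move=> a M N; rewrite /ur_conj conj_mx_is_linear; apply/matrixP=> i j; rewrite !mxE. Qed.
HB.instance Definition _ := GRing.isLinear.Build F _ _ _ ur_conj ur_conj_is_linear.

Fact dr_conj_is_linear : linear dr_conj.
Proof. by move=> a M N; rewrite /dr_conj conj_mx_is_linear; apply/matrixP=> i j; rewrite !mxE. Qed.
HB.instance Definition _ := GRing.isLinear.Build F _ _ _ dr_conj dr_conj_is_linear.

Lemma conj_mxE M : conj_mx M *m B = B *m M.
Proof. by rewrite /conj_mx mulmxKV. Qed.

Lemma conj_mx_scalar a : conj_mx a%:M = a%:M.
Proof. by rewrite /conj_mx scalar_mxC -mulmxA mulmxV // mulmx1. Qed.

Lemma eigenvalue_conj M a : eigenvalue (conj_mx M) a = eigenvalue M a.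
Proof.
have -> : eigenvalue (conj_mx M) a = (\det (conj_mx (M - a%:M)) == 0).
  rewrite eigenvalueE linearB; congr (\det (_ - _) == 0).
  exact/esym/conj_mx_scalar.
rewrite eigenvalueE !det_mulmx det_inv mulrAC mulfV ?mul1r //.
by rewrite -unitfE -unitmxE.
Qed.

Lemma eigenvalue_lblock (a b : F) (c : 'cV[F]_m) (N : 'M[F]_m) :
  eigenvalue (block_mx a%:M 0 c N : 'M[F]_(1 + m)) b = (b == a) || eigenvalue N b.
Proof.
rewrite !eigenvalueE (scalar_mx_block 1 m b).
rewrite opp_block_mx add_block_mx oppr0 addr0 det_lblock mulf_eq0.
by rewrite -raddfB det_scalar1 subr_eq0 eq_sym.
Qed.

(** Vanishing of the upper right block amounts to [m] linear conditions and makes the first row of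
    [B] an eigenvector. Under them the lower right block is the action on the quotient by that row:
    [W] is the image of this action and [K] its kernel. *)
Lemma deflation_dim (V : {vspace 'M[F]_(1 + m)}) :
  exists (W : {vspace 'M[F]_m}) (K : {vspace 'M[F]_(1 + m)}),
  [/\ (\dim V <= m + \dim W + \dim K)%N,
      (K <= V)%VS,
      forall M, M \in K -> exists phi, M = phi *m usubmx B
    & forall N, N \in W -> exists M a c, M \in V /\ conj_mx M = block_mx a%:M 0 c N].
Proof.
pose g1 := linfun ur_conj.
pose g2 := linfun dr_conj.
pose V1 := (V :&: lker g1)%VS.
exists (g2 @: V1)%VS, (V1 :&: lker g2)%VS; split.
- rewrite -(limg_ker_dim g1 V) -/V1 -(limg_ker_dim g2 V1) addnC [X in (_ + X)%N]addnC addnA.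
  rewrite leq_add2r leq_add2r.
  by apply: leq_trans (dimvS (subvf _)) _; rewrite dimvf /dim /= mul1n.
- by rewrite -capvA capvSl.
- move=> M; rewrite /V1 /g1 /g2 !memv_cap !memv_ker !lfunE /= => /andP[/andP[_ /eqP h1] /eqP h2].
  have blk : conj_mx M *m B = col_mx (ulsubmx (conj_mx M)) (dlsubmx (conj_mx M)) *m usubmx B.
    rewrite -{1}[conj_mx M]submxK (h1 : ursubmx _ = _) (h2 : drsubmx _ = _).
    by rewrite -{1}[B]vsubmxK mul_block_col !mul0mx !addr0 mul_col_mx.
  exists (invmx B *m col_mx (ulsubmx (conj_mx M)) (dlsubmx (conj_mx M))).
  by rewrite -mulmxA -blk conj_mxE mulKmx.
- move=> N /memv_imgP[M]; rewrite /V1 /g1 /g2 memv_cap memv_ker !lfunE /= => /andP[MV /eqP h] ->.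
  exists M, (ulsubmx (conj_mx M) 0 0), (dlsubmx (conj_mx M)); split => //.
  rewrite -[LHS]submxK (h : ursubmx _ = _); congr block_mx; exact: mx11_scalar.
Qed.

End Deflation.

(** * The tournament argument in an affine hyperplane *)

(** [Q] projects onto the subspace where the cube lives. The condition [dot u f = 1] keeps the
    vertices away from a chosen subspace, in particular from 0, while the functional found still
    vanishes on the whole image of [Q]. *)
Lemma hyperplane_tournament (F : fieldType) n (Q : 'M[F]_n) (w : 'rV[F]_n) (f : 'cV[F]_n)
    (R : 'rV[F]_n -> 'cV[F]_n -> Prop) :
  Q *m Q = Q -> w *m Q = w -> dot w f = 1 ->
  (forall u, u *m Q = u -> dot u f = 1 -> exists th, R u th) ->
  (forall u v th et, u *m Q = u -> v *m Q = v -> R u th -> R v et ->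
     dot u et = 0 \/ dot v th = 0) ->
  exists u th, [/\ u *m Q = u, dot u f = 1, R u th & Q *m th = 0].
Proof.
move=> QQ wQ wf exR tour.
(* The rows of [E] span the part of the image of [Q] killed by [f], so the cube
   based at [w] stays in the affine hyperplane [f = 1]. *)
pose E := Q - Q *m f *m w.
have EQ : E *m Q = E by rewrite mulmxBl QQ -[_ *m w *m Q]mulmxA wQ.
have Ef : E *m f = 0 by rewrite mulmxBl -[_ *m w *m f]mulmxA dotE wf mulmx1 subrr.
have uQ I : cube_point w E I *m Q = cube_point w E I.
  rewrite mulmxDl wQ mulmx_suml; congr (_ + _).
  by apply: eq_bigr => i _; rewrite -row_mul EQ.
have uf I : dot (cube_point w E I) f = 1.
  rewrite dotDl wf /dot mulmx_suml big1 ?mxE ?addr0 // => i _.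
  by rewrite -row_mul Ef row0.
have /fin_all_exists[th Rth] : forall I, exists th, R (cube_point w E I) th.
  by move=> I; apply: exR.
have [I [wI EI]] : exists I, w *m th I = 0 /\ E *m th I = 0.
  apply: cube_tournament => I J.
  exact: (tour _ _ _ _ (uQ I) (uQ J) (Rth I) (Rth J)).
exists (cube_point w E I), (th I); split=> //.
by move: EI; rewrite mulmxBl -[_ *m w *m _]mulmxA wI mulmx0 subr0.
Qed.

(** If every nonzero row had a nonzero companion [th], the tournament with [Q = 1] would give a
    nonzero [th] killing all rows. *)
Lemma exists_good_row (F : fieldType) m (V : {vspace 'M[F]_(1 + m)}) :
  (forall (u v : 'rV[F]_(1 + m)) (th et : 'cV[F]_(1 + m)), th *m u \in V -> et *m v \in V ->
     dot u et = 0 \/ dot v th = 0) ->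
  exists2 x : 'rV[F]_(1 + m), x != 0 & forall phi, phi *m x \in V -> phi = 0.
Proof.
move=> tour; apply: NNPP => nogood.
pose e : 'rV[F]_(1 + m) := delta_mx 0 0.
have ee : dot e e^T = 1 by rewrite /dot trmx_delta mul_delta_mx mxE !eqxx.
have [|||||u [th [_ _ [th0 _]]]] := @hyperplane_tournament F _ 1%:M e e^T
  (fun u th => th != 0 /\ th *m u \in V).
- exact: mulmx1.
- exact: mulmx1.
- exact: ee.
- move=> u _ uf; apply: NNPP => H; apply: nogood; exists u.
    by apply: contra_eq_neq uf => ->; rewrite dot0l eq_sym oner_eq0.
  move=> phi phiV; apply/eqP; apply: contraT => phi0.
  by case: H; exists phi.
- by move=> u v th et _ _ [_ ?] [_ ?]; apply: tour.
by rewrite mul1mx => /eqP; rewrite (negbTE th0).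
Qed.

Lemma deflation (F : fieldType) m (V : {vspace 'M[F]_(1 + m)}) (x : 'rV[F]_(1 + m)) :
  x != 0 ->
  exists (B : 'M[F]_(1 + m)) (W : {vspace 'M[F]_m}) (K : {vspace 'M[F]_(1 + m)}),
  [/\ B \in unitmx /\ usubmx B = x,
      (\dim V <= m + \dim W + \dim K)%N,
      forall M, M \in K -> M \in V /\ exists phi, M = phi *m x
    & forall N, N \in W -> exists M a c, M \in V /\ conj_mx B M = block_mx a%:M 0 c N].
Proof.
move=> /exists_unitmx_row[B [uB Bx]].
have [W [K [dimV KV Kx Wl]]] := deflation_dim uB V.
exists B, W, K; split=> // M MK; split; first exact: (subvP KV).
by rewrite -Bx; apply: Kx.
Qed.

(** * Spaces whose matrices have at most one eigenvalue *)

Definition at_most_one_eigenvalue (F : fieldType) n (M : 'M[F]_n) :=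
  forall a b, eigenvalue M a -> eigenvalue M b -> a = b.

Lemma neq1N1 (F : fieldType) : (2%:R : F) != 0 -> (1 : F) <> - 1.
Proof. by move=> h /eqP; rewrite -subr_eq0 opprK (negbTE h). Qed.

Lemma dim_one_eigenvalue (F : fieldType) n (V : {vspace 'M[F]_n}) :
  (2%:R : F) != 0 ->
  (forall M, M \in V -> at_most_one_eigenvalue M) -> (\dim V <= 'C(n, 2) + 1)%N.
Proof.
move=> ch2; elim: n V => [|m IHm] V V1.
  by apply: leq_trans (dimvS (subvf _)) _; rewrite dimvf.
(* Size one is treated apart: a rank-one matrix is then not singular, and [noloop] below would
   fail. *)
case: (posnP m) => [m0|m_gt0].
  by subst m; apply: leq_trans (dimvS (subvf _)) _; rewrite dimvf.
have noloop (x : 'rV[F]_(1 + m)) (phi : 'cV[F]_(1 + m)) : phi *m x \in V -> dot x phi = 0.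
  move=> hV; apply/eqP; apply: contraT => h.
  have e0 : eigenvalue (phi *m x) 0.
    by apply: eigenvalue0; apply: leq_ltn_trans (rank_rank1 _ _) _; rewrite ltnS.
  by case/eqP: (h); apply: (V1 _ hV) => //; apply: eigenvalue_rank1.
have [x x0 good] : exists2 x : 'rV[F]_(1 + m), x != 0 & forall phi, phi *m x \in V -> phi = 0.
  apply: exists_good_row => u v th et uV vV.
  case: (eqVneq (dot u et) 0) => [->|uet]; first by left.
  case: (eqVneq (dot v th) 0) => [->|vth]; first by right.
  have [M [MV _ M1 MN1]] := swap_eigenvalues (noloop _ _ uV) (noloop _ _ vV) vth uet uV vV.
  by case: (neq1N1 ch2); apply: (V1 _ MV).
have [B [W [K [[uB Bx] dimV Kx Wl]]]] := deflation V x0.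
have K0 : K = 0%VS.
  apply/eqP; rewrite -subv0; apply/subvP=> M /Kx[MV [phi E]].
  by rewrite memv0 E (good phi) ?mul0mx // -E.
have dW : (\dim W <= 'C(m, 2) + 1)%N.
  apply: IHm => N /Wl[M [a [c [MV E]]]] b1 b2 h1 h2.
  by apply: (V1 _ MV); rewrite -(eigenvalue_conj uB) E eigenvalue_lblock ?h1 ?h2 orbT.
rewrite K0 dimv0 in dimV; apply: leq_trans dimV _; rewrite binS bin1; lia.
Qed.

(** * Rank-one matrices in an adapted basis, and separating functionals *)

Lemma conj_rank1 (F : fieldType) m (B : 'M[F]_(1 + m)) (phi : 'cV[F]_(1 + m)) :
  B \in unitmx ->
  conj_mx B (phi *m usubmx B) =
    block_mx (dot (usubmx B) phi)%:M 0 (dsubmx B *m phi) 0.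
Proof.
move=> uB; have -> : conj_mx B (phi *m usubmx B) = (B *m phi) *m row_mx 1%:M 0.
  rewrite /conj_mx -!mulmxA; congr (_ *m (_ *m _)).
  have := congr1 (@usubmx F 1 m (1 + m)) (mulmxV uB).
  rewrite -mul_usub_mx => ->; rewrite (scalar_mx_block 1 m 1) /block_mx col_mxKu.
  by [].
rewrite -{1}[B]vsubmxK mul_col_mx mul_col_row !mulmx0 !mulmx1.
by rewrite dotE.
Qed.

(** The projection [g] with kernel [A] does not kill [w]; [f] is a coordinate of [g] that is nonzero
    at [w], normalised there. *)
Lemma separating_functional (F : fieldType) n (A : {vspace 'rV[F]_n}) (w : 'rV[F]_n) :
  w \notin A -> exists2 f : 'cV[F]_n, dot w f = 1 & forall v, v \in A -> dot v f = 0.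
Proof.
move=> wA; pose g := (\1 - projv A)%VF.
have gA v : v \in A -> g v = 0.
  by move=> vA; rewrite !lfunE /= !lfunE /= projv_id // subrr.
have [j gj] : exists j, g w 0 j != 0.
  apply/rV0Pn; apply: contra wA => /eqP.
  rewrite !lfunE /= !lfunE /= => /eqP; rewrite subr_eq0 => /eqP->.
  exact: memv_proj.
pose f := (g w 0 j)^-1 *: col j (lin1_mx g).
have fE v : dot v f = (g w 0 j)^-1 * g v 0 j.
  rewrite dotZr; congr (_ * _); rewrite -[g v]mul_rV_lin1 /dot !mxE.
  by apply: eq_bigr => k _; rewrite mxE.
exists f; first by rewrite fE mulVf.
by move=> v /gA h; rewrite fE h mxE mulr0.
Qed.

(** Rank below [n] adds the eigenvalue 0, and 0, 1, -1 are distinct outside characteristic 2. *)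
Lemma two_eigenvalues_rank2 (F : fieldType) n (M : 'M[F]_n) :
  (2%:R : F) != 0 -> (2 < n)%N -> (\rank M <= 2)%N ->
  eigenvalue M 1 -> eigenvalue M (- 1) -> ~ at_most_two_eigenvalues M.
Proof.
move=> ch2 n3 rM M1 MN1 /(_ 0 1 (- 1) (eigenvalue0 (leq_ltn_trans rM n3)) M1 MN1).
case=> [/esym/eqP|/esym/eqP|/(neq1N1 ch2)] //; rewrite ?oppr_eq0 oner_eq0 //.
Qed.

(** * Spaces with at most two eigenvalues in which every nonzero row is the row factor of a nonzero
    rank-one member *)

Section TwoEigenvalues.
Variables (F : fieldType) (m : nat) (V : {vspace 'M[F]_(1 + m)}).
Hypothesis ch2 : (2%:R : F) != 0.
Hypothesis m_gt1 : (1 < m)%N.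
Hypothesis V2 : forall M, M \in V -> at_most_two_eigenvalues M.

Lemma no_swap (y z : 'rV[F]_(1 + m)) (th et : 'cV[F]_(1 + m)) :
  dot y th = 0 -> dot z et = 0 -> th *m y \in V -> et *m z \in V ->
  dot y et = 0 \/ dot z th = 0.
Proof.
move=> yth zet yV zV.
case: (eqVneq (dot y et) 0) => [->|yet]; first by left.
case: (eqVneq (dot z th) 0) => [->|zth]; first by right.
have [M [MV rM M1 MN1]] := swap_eigenvalues yth zet zth yet yV zV.
by case: (two_eigenvalues_rank2 ch2 _ rM M1 MN1 (V2 MV)).
Qed.

(** Otherwise, with [psi] rescaled to [psi1], the matrix [M] preserves the span of [u] and [x] and
    is triangular there with diagonal 1, -1; having rank at most two, it also has the eigenvalue
    0. *)
Lemma loop_orthogonal (x u : 'rV[F]_(1 + m)) (phi psi : 'cV[F]_(1 + m)) :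
  dot x phi = 1 -> phi *m x \in V -> dot u phi = 0 -> psi *m u \in V ->
  dot u psi = 0.
Proof.
move=> xphi xV uphi uV; apply/eqP; apply: contraT => upsi.
pose psi1 := (dot u psi)^-1 *: psi.
have upsi1 : dot u psi1 = 1 by rewrite dotZr mulVf.
pose M := (- phi) *m x + psi1 *m u.
have uM : u *m M = u.
  by rewrite mulmxDr !mul_rank1 upsi1 scale1r -scaleN1r dotZr uphi mulr0 scale0r add0r.
have xM : x *m M = - x + dot x psi1 *: u.
  by rewrite mulmxDr !mul_rank1 -[- phi]scaleN1r dotZr xphi mulr1 scaleN1r.
have MV : M \in V by rewrite memvD // ?mulNmx ?memvN // -scalemxAl memvZ.
have rM : (\rank M <= 2)%N := rank_rank2 _ _ _ _.
clearbody M psi1.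
case: (two_eigenvalues_rank2 ch2 _ rM _ _ (V2 MV)) => //.
- apply/eigenvalueP; exists u; first by rewrite uM scale1r.
  by apply: contraNneq upsi => ->; rewrite dot0l.
(* [k] solves [dot x psi1 + k = - k], which makes [x + k *: u] an eigenvector for -1. *)
- pose k := - (dot x psi1 / 2%:R).
  apply/eigenvalueP; exists (x + k *: u).
    rewrite mulmxDl -scalemxAl uM xM scaleN1r opprD -addrA -scalerDl; congr (_ + _).
    by rewrite -scaleNr; congr (_ *: _); rewrite /k; field.
  apply: contra_eq_neq xphi => h.
  have := congr1 (fun v => dot v phi) h.
  by rewrite /= dotDl dotZl uphi mulr0 addr0 dot0l => ->; rewrite eq_sym oner_eq0.
Qed.

(* If [phi *m y] were not in [V], the tournament argument on the kernel of [phi],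
   relative to the [u] with [phi *m u] in [V], would produce a nonzero [th] in [V^u]
   vanishing on that kernel, hence proportional to [phi]. *)
Lemma full_column :
  (forall x : 'rV[F]_(1 + m), x != 0 -> exists2 phi, phi != 0 & phi *m x \in V) ->
  exists (x : 'rV[F]_(1 + m)) phi, dot x phi = 1 /\ forall y, phi *m y \in V.
Proof.
move=> bad.
have [x [phi [xphi xV]]] :
    exists (x : 'rV[F]_(1 + m)) phi, dot x phi = 1 /\ phi *m x \in V.
  apply: NNPP => noloop.
  have noloop' (x : 'rV[F]_(1 + m)) phi : phi *m x \in V -> dot x phi = 0.
    move=> xV; apply/eqP; apply: contraT => h; case: noloop.
    exists x, ((dot x phi)^-1 *: phi); split; first by rewrite dotZr mulVf.
    by rewrite -scalemxAl memvZ.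
  have [x x0 good] : exists2 x : 'rV[F]_(1 + m), x != 0 &
      forall phi, phi *m x \in V -> phi = 0.
    apply: exists_good_row => u v th et uV vV.
    by apply: no_swap; rewrite ?noloop'.
  by have [phi phi0 /good/eqP] := bad _ x0; rewrite (negbTE phi0).
exists x, phi; split=> // y; apply: contraT => yV.
pose A : {vspace 'rV[F]_(1 + m)} := (linfun (mulmx phi) @^-1: V)%VS.
have inA v : (v \in A) = (phi *m v \in V) by rewrite -memv_preim lfunE.
(* The projection onto the kernel of [phi] along [x]. *)
pose Q : 'M[F]_(1 + m) := 1%:M - phi *m x.
have Qphi : Q *m phi = 0.
  by rewrite mulmxBl mul1mx -mulmxA dotE xphi mulmx1 subrr.
have QQ : Q *m Q = Q by rewrite {2}/Q mulmxBr mulmx1 mulmxA Qphi mul0mx subr0.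
have Qker u : u *m Q = u -> dot u phi = 0.
  by move=> <-; rewrite /dot -mulmxA Qphi mulmx0 mxE.
pose w := y *m Q.
have wA : w \notin A.
  rewrite inA /w mulmxBr mulmx1 mul_rank1 mulmxBr -scalemxAr.
  apply: contra yV => h.
  by rewrite -[phi *m y](subrK (dot y phi *: (phi *m x))) memvD // memvZ.
(* Since [f] vanishes on [A], each [u] with [dot u f = 1] has [phi *m u] outside [V]. *)
have [f wf Af] := separating_functional wA.
have [|||u [th [uQ uf [th0 uV] Qth]]] := @hyperplane_tournament F _ Q w f
  (fun u th => th != 0 /\ th *m u \in V) QQ _ wf.
- by rewrite /w -mulmxA QQ.
- move=> u _ uf; have [|th th0 uV] := bad u; last by exists th.
  by apply: contra_eq_neq uf => ->; rewrite dot0l eq_sym oner_eq0.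
- move=> u v th et uQ vQ [_ uV] [_ vV].
  by apply: no_swap => //; apply: (loop_orthogonal xphi xV); rewrite ?Qker.
move: Qth; rewrite mulmxBl mul1mx -mulmxA dotE mul_mx_scalar => /eqP.
rewrite subr_eq0 => /eqP thE.
have c0 : dot x th != 0.
  by apply: contraNneq th0 => h; rewrite thE h scale0r.
have : u \in A.
  rewrite inA; have -> : phi = (dot x th)^-1 *: th.
    by rewrite {2}thE scalerA mulVf ?scale1r.
  by rewrite -scalemxAl memvZ.
by move/Af => h; move: uf; rewrite h => /eqP; rewrite eq_sym oner_eq0.
Qed.

(** The difference [d] kills [x]. Were it nonzero, some [z] in the kernel of [phi] would have
    [dot z d != 0], and the members [d *m x] and [phi *m z] would contradict [no_swap]. *)
Lemma full_column_unique (x : 'rV[F]_(1 + m)) (phi psi : 'cV[F]_(1 + m)) :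
  dot x phi = 1 -> (forall y, phi *m y \in V) -> psi *m x \in V ->
  psi = dot x psi *: phi.
Proof.
move=> xphi full xV; apply/eqP; rewrite -subr_eq0; apply: contraT => d0.
pose d := psi - dot x psi *: phi.
have xd : dot x d = 0 by rewrite dotDr -scaleNr dotZr xphi mulr1 subrr.
have dV : d *m x \in V by rewrite mulmxBl memvB // -scalemxAl memvZ.
have [i di] : exists i, d i 0 != 0 by apply/cV0Pn.
pose y : 'rV[F]_(1 + m) := delta_mx 0 i.
have yd : dot y d = d i 0 by rewrite /dot -rowE mxE.
pose z := y - dot y phi *: x.
have zphi : dot z phi = 0 by rewrite dotDl -scaleNr dotZl xphi mulr1 subrr.
have zd : dot z d != 0 by rewrite dotDl -scaleNr dotZl xd mulr0 addr0 yd.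
case: (no_swap xd zphi dV (full z)) => /eqP; last by rewrite (negbTE zd).
by rewrite xphi oner_eq0.
Qed.

Lemma dim_full_column (x : 'rV[F]_(1 + m)) (phi : 'cV[F]_(1 + m)) :
  dot x phi = 1 -> (forall y, phi *m y \in V) -> (\dim V <= 'C(m.+1, 2) + 2)%N.
Proof.
move=> xphi full.
have x0 : x != 0 by apply: contra_eq_neq xphi => ->; rewrite dot0l eq_sym oner_eq0.
have [B [W [K [[uB Bx] dimV Kx Wl]]]] := deflation V x0.
have dK : (\dim K <= 1)%N.
  have : (K <= <[phi *m x]>)%VS.
    apply/subvP=> M /Kx[MV [psi E]]; rewrite E in MV *.
    by rewrite (full_column_unique xphi full MV) -scalemxAl memvZ // memv_line.
  by move/dimvS/leq_trans; apply; rewrite dim_vline leq_b1.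
have dW : (\dim W <= 'C(m, 2) + 1)%N.
  apply: dim_one_eigenvalue => // N /Wl[M [a [c [MV E]]]] b1 b2 h1 h2.
  apply/eqP; apply: contraT => b12; pose t := b1 + b1 - b2. (* differs from both b1 and b2 *)
  (* Adding a multiple of [phi *m x] moves the corner entry from [a] to [t] without changing the
     quotient action [N]. *)
  have M'V : M + (t - a) *: (phi *m x) \in V by rewrite memvD // memvZ.
  have E' : conj_mx B (M + (t - a) *: (phi *m x)) =
      block_mx t%:M 0 (c + (t - a) *: (dsubmx B *m phi)) N.
    rewrite addrC (conj_mx_is_linear B) E -Bx conj_rank1 // Bx xphi.
    rewrite scale_block_mx add_block_mx !scaler0 !addr0 !add0r; congr block_mx.
      by rewrite scale_scalar_mx -raddfD mulr1 /= subrK.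
    by rewrite addrC.
  have ev b : eigenvalue (M + (t - a) *: (phi *m x)) b = (b == t) || eigenvalue N b.
    by rewrite -(eigenvalue_conj uB) E' eigenvalue_lblock.
  case: (V2 M'V (a := t) (b := b1) (c := b2)); rewrite ?ev ?eqxx ?h1 ?h2 ?orbT // => /eqP.
  - by rewrite -subr_eq0 /t addrAC addrK subr_eq0 (negbTE b12).
  - rewrite -subr_eq0 (_ : t - b2 = 2%:R * (b1 - b2)); last by rewrite /t; ring.
    by rewrite mulf_eq0 (negbTE ch2) subr_eq0 (negbTE b12).
  - by rewrite (negbTE b12).
apply: leq_trans dimV _; rewrite binS bin1; lia.
Qed.

End TwoEigenvalues.

(** * Deflation from size three to size two *)

Lemma det_mx2 (F : fieldType) (A : 'M[F]_2) : \det A = A 0 0 * A 1 1 - A 0 1 * A 1 0.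
Proof.
have e1 : lift (0 : 'I_2) (0 : 'I_1) = 1 by apply/val_inj.
have e2 : lift (1 : 'I_2) (0 : 'I_1) = 0 by apply/val_inj.
rewrite (expand_det_row _ 0) big_ord_recl big_ord1 /cofactor !det_mx11 !mxE /=.
by rewrite e1 e2 expr0 expr1 mul1r mulN1r mulrN.
Qed.

Definition mx2 (F : fieldType) (p q r s : F) : 'M[F]_2 :=
  \matrix_(i, j) if i == 0 then if j == 0 then p else q else if j == 0 then r else s.

Lemma eigenvalue_mx2 (F : fieldType) (p q r s t : F) :
  (p - t) * (s - t) = q * r -> eigenvalue (mx2 p q r s) t.
Proof.
by move=> h; rewrite eigenvalueE det_mx2 !mxE /= !mulr1n !mulr0n !subr0 h subrr.
Qed.

(* The eigenvalue [a] on the deflated line would be a linear form of [N] forced to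
   lie among the eigenvalues of [N] whenever these are distinct. *)
Lemma deflated_not_full (F : fieldType) (V : {vspace 'M[F]_(1 + 2)}) (B : 'M[F]_(1 + 2)) :
  (2%:R : F) != 0 -> B \in unitmx ->
  (forall M, M \in V -> at_most_two_eigenvalues M) ->
  ~ (forall N : 'M[F]_2, exists M a c, M \in V /\ conj_mx B M = block_mx a%:M 0 c N).
Proof.
move=> ch2 uB V2 full.
(* [P] relates a quotient action [N] to the possible eigenvalues on the deflated line; it is
   compatible with linear combinations. *)
pose P (N : 'M[F]_2) a := exists M c, M \in V /\ conj_mx B M = block_mx a%:M 0 c N.
have exP N : exists a, P N a by have [M [a [c h]]] := full N; exists a, M, c.
have PD k N1 a1 N2 a2 : P N1 a1 -> P N2 a2 -> P (k *: N1 + N2) (k * a1 + a2).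
  move=> [M1 [c1 [V1 E1]]] [M2 [c2 [V2' E2]]].
  exists (k *: M1 + M2), (k *: c1 + c2); split; first by rewrite memvD // memvZ.
  rewrite (conj_mx_is_linear B) E1 E2 scale_block_mx add_block_mx scaler0 addr0.
  by rewrite scale_scalar_mx -raddfD.
have Pev N a s t : P N a -> eigenvalue N s -> eigenvalue N t -> s != t -> a = s \/ a = t.
  move=> [M [c [MV E]]] Ns Nt /eqP st.
  have ev b : eigenvalue M b = (b == a) || eigenvalue N b.
    by rewrite -(eigenvalue_conj uB) E eigenvalue_lblock.
  by case: (V2 _ MV a s t); rewrite ?ev ?eqxx ?Ns ?Nt ?orbT //; [left | right].
have mx2D k p q r s p' q' r' s' : k *: mx2 p q r s + mx2 p' q' r' s' =
    mx2 (k * p + p') (k * q + q') (k * r + r') (k * s + s').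
  by apply/matrixP=> i j; rewrite !mxE; case: ifP => _; case: ifP.
have n10 : (1 : F) != 0 := oner_neq0 _.
have n1N : (1 : F) != - 1 by apply/eqP/neq1N1.
have [a Pa] := exP (mx2 1 0 0 0).
have [b Pb] := exP (mx2 0 1 0 0).
have [c Pc] := exP (mx2 0 0 1 0).
have [d Pd] := exP (mx2 0 0 0 1).
have a01 : a = 1 \/ a = 0.
  by apply: (Pev _ _ _ _ Pa) => //; apply: eigenvalue_mx2; ring.
(* Both [Ne] and its negative, added to [mx2 1 0 0 0], keep the eigenvalues 1 and 0. Hence [a + e]
   and [a - e] lie in {0, 1}, as does [a], and this forces [e = 0] as 2 is nonzero. *)
have key e Ne (Pe : P Ne e) : (forall k, k * k = 1 -> eigenvalue (k *: Ne + mx2 1 0 0 0) 1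
     /\ eigenvalue (k *: Ne + mx2 1 0 0 0) 0) -> e = 0.
  move=> ev; have [|e1 e0] := ev 1; first by rewrite mulr1.
  have [|f1 f0] := ev (- 1); first by rewrite mulrNN mulr1.
  have A1 := Pev _ _ _ _ (PD 1 _ _ _ _ Pe Pa) e1 e0 n10.
  have A2 := Pev _ _ _ _ (PD (- 1) _ _ _ _ Pe Pa) f1 f0 n10.
  have two0 : 2%:R = 0 :> F -> e = 0 by move=> h; case/eqP: ch2.
  case: a01 A1 A2 => -> [A1|A1] [A2|A2].
  - by apply: (addIr 1); rewrite add0r -[RHS]A1 mul1r.
  - by apply: (addIr 1); rewrite add0r -[RHS]A1 mul1r.
  - by apply: oppr_inj; apply: (addIr 1); rewrite oppr0 add0r -[RHS]A2 mulN1r.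
  - apply: two0; rewrite (_ : 2%:R = (1 * e + 1) + (- 1 * e + 1)); last by ring.
    by rewrite A1 A2 addr0.
  - apply: two0; have : (1 * e + 0) + (- 1 * e + 0) = 0 by ring.
    by rewrite A1 A2.
  - by apply: oppr_inj; rewrite oppr0 -[RHS]A2 mulN1r addr0.
  - by rewrite -[RHS]A1 mul1r addr0.
  - by rewrite -[RHS]A1 mul1r addr0.
have b0 : b = 0.
  apply: key Pb _ => k kk; rewrite mx2D; split; apply: eigenvalue_mx2; ring.
have c0 : c = 0.
  apply: key Pc _ => k kk; rewrite mx2D; split; apply: eigenvalue_mx2; ring.
(* The matrix [mx2 0 1 1 0] has eigenvalues 1 and -1, but the value attached to it is
   [b + c = 0]. *)
have := PD 1 _ _ _ _ Pb Pc; rewrite mx2D b0 c0 => Pbc.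
case: (Pev _ _ 1 (- 1) Pbc) => //; first 2 last.
- by rewrite mulr0 addr0 => /esym/eqP; rewrite oner_eq0.
- by rewrite mulr0 addr0 => /esym/eqP; rewrite oppr_eq0 oner_eq0.
- by apply: eigenvalue_mx2; ring.
- by apply: eigenvalue_mx2; ring.
Qed.

(** * Induction on the size *)

Theorem mainTheorem1 (F : fieldType) (n : nat)
  (hchar : (2%:R : F) != 0) (hn : (3 <= n)%N)
  (V : {vspace 'M[F]_n})
  (hV : forall M : 'M[F]_n, M \in V -> at_most_two_eigenvalues M) :
  (\dim V <= 'C(n, 2) + 2)%N.
Proof.
elim: n hn V hV => [//|m IHm] m_gt1 V hV.
have [good|bad] := classic (exists2 x : 'rV[F]_(1 + m), x != 0 &
    forall phi, phi *m x \in V -> phi = 0); last first.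
  have [x x0|x [phi [xphi full]]] := full_column hchar m_gt1 hV.
    apply: NNPP => H; apply: bad; exists x => // phi phiV.
    by apply/eqP; apply: contraT => phi0; case: H; exists phi.
  exact: (dim_full_column hchar m_gt1 hV xphi full).
have [x x0 {}good] := good.
have [B [W [K [[uB Bx] dimV Kx Wl]]]] := deflation (V : {vspace 'M[F]_(1 + m)}) x0.
have K0 : K = 0%VS.
  apply/eqP; rewrite -subv0; apply/subvP=> M /Kx[MV [phi E]].
  by rewrite memv0 E (good phi) ?mul0mx // -E.
rewrite K0 dimv0 addn0 in dimV.
have dW : (\dim W <= 'C(m, 2) + 2)%N.
  have [m3|m3] := ltnP 2 m.
    apply: IHm => // N /Wl[M [a [c [MV E]]]] b1 b2 b3 h1 h2 h3.
    by apply: (hV _ MV); rewrite -(eigenvalue_conj uB) E eigenvalue_lblock ?h1 ?h2 ?h3 orbT.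
  have m2 : m = 2 by apply/eqP; rewrite eqn_leq m3; apply: m_gt1.
  (* The induction hypothesis has no analogue at size two, where every matrix has at most two
     eigenvalues. The bound there is 3, one less than the dimension of the full matrix space, so it
     suffices to exclude that [W] is everything. *)
  subst m; rewrite leqNgt; apply/negP => dW.
  have Wfull : W = fullv.
    by apply/eqP; rewrite eqEdim subvf dimvf /dim.
  by case: (deflated_not_full hchar uB hV) => N; apply: Wl; rewrite Wfull memvf.
apply: leq_trans dimV _; rewrite binS bin1; lia.
Qed.
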